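(* Let $\Omega$ be a metrizable separable space and $c$ a Prokhorov capacity on $\mathcal{L}$. Let $\rho$ be a convex risk measure on $L^1(c)$. Then $\rho$ is continuous and $$\forall X\in L^1(c),\quad \rho(X)=\sup_{Q\in\mathcal{P}'}\big(E_Q[-X]-\alpha(Q)\big),\qquad \alpha(Q)=\sup_{X\in L^1(c)}\big(E_Q[-X]-\rho(X)\big),$$ where $\mathcal{P}'$ is the set of probability measures on $(\Omega,\mathcal{B}(\Omega))$ belonging to $L^1(c)^*$.
   Context: $\Omega$ is a metrizable separable space with Borel $\sigma$-algebra $\mathcal{B}(\Omega)$; $\mathcal{L}\subset\mathcal{C}_b(\Omega)$ is a linear subspace which is a vector lattice, contains the constants and generates the topology of $\Omega$. A capacity on $\mathcal{L}$ is a seminorm $c$ on $\mathcal{L}$ with $c(f)\le c(g)$ whenever $|f|\le|g|$, and $\inf_n c(f_n)=0$ for every sequence $f_n\in\mathcal{L}$ decreasing pointwise to $0$. It is extended to all real functions by $c(f)=\sup\{c(\varphi):\varphi\in\mathcal{L},0\le\varphi\le f\}$ for $f\ge 0$ lower semicontinuous and $c(g)=\inf\{c(f): f \text{ l.s.c.}, f\ge|g|\}$ in general. $\mathcal{L}^1(c)$ is the closure of $\mathcal{L}$ in $\{g: c(g)<\infty\}$ for $c$ and $L^1(c)$ is its quotient by $c$-null elements, a Banach space. $c$ is Prokhorov if for every $\varepsilon>0$ there is a compact $K$ with $c(f)\le\varepsilon$ for all $f\in\mathcal{L}$ with $|f|\le 1_{\Omega\setminus K}$. Order on $L^1(c)$: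 $X\ge0$ iff there are $f_n\in\mathcal{L}$, $f_n\ge0$, with $c(g-f_n)\to0$ for every representative $g$ of $X$; $X\le Y$ iff $Y-X\ge0$. A convex risk measure on $L^1(c)$ is a map $\rho:L^1(c)\to\mathbb{R}$ that is monotone ($X\le Y\Rightarrow\rho(X)\ge\rho(Y)$), convex and translation invariant ($\rho(X+a)=\rho(X)-a$). A Borel probability measure $Q$ belongs to $L^1(c)^*$ if $f\mapsto\int f\,dQ$ defines a continuous linear form on $L^1(c)$, whose value at $X$ is denoted $E_Q[X]$. *)

(* Defs.v *)
From HB Require Import structures.
From mathcomp Require Import all_boot all_order all_algebra.
From mathcomp Require Import all_classical all_reals all_analysis.
Set Implicit Arguments. Unset Strict Implicit. Unset Printing Implicit Defensive.
Import Order.TTheory GRing.Theory Num.Theory.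
Import numFieldNormedType.Exports.
Local Open Scope classical_set_scope.
Local Open Scope ring_scope.

Section Defs.
Variables (R : realType) (T : ptopologicalType).

Definition metrizable :=
  exists d : T -> T -> R,
    (forall x y, 0 <= d x y) /\ (forall x y, d x y = 0 <-> x = y) /\
    (forall x y, d x y = d y x) /\ (forall x y z, d x z <= d x y + d y z) /\
    (forall A : set T, open A <->
       forall x, A x -> exists2 e : R, 0 < e & [set y | d x y < e] `<=` A).

Definition separable := exists D : set T, countable D /\ closure D = setT.

Definition bounded_continuous (f : T -> R) :=
  continuous f /\ exists M : R, forall x, `|f x| <= M.

Definition vector_lattice_Cb (L : set (T -> R)) :=
  (forall f, L f -> bounded_continuous f) /\
  (forall f g, L f -> L g -> L (f \+ g)) /\
  (forall (a : R) f, L f -> L (fun x => a * f x)) /\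
  (forall f g, L f -> L g -> L (fun x => Num.max (f x) (g x))) /\
  (forall a : R, L (cst a)).

Definition generates_topology (L : set (T -> R)) :=
  forall (A : set T) (x : T), open A -> A x ->
    exists (n : nat) (fs : nat -> T -> R) (e : R),
      [/\ 0 < e, (forall i, (i < n)%N -> L (fs i)) &
          [set y | forall i, (i < n)%N -> `|fs i y - fs i x| < e] `<=` A].

Definition capacity (L : set (T -> R)) (c : (T -> R) -> R) :=
  [/\ (forall f g, L f -> L g -> c (f \+ g) <= c f + c g),
      (forall (a : R) f, L f -> c (fun x => a * f x) = `|a| * c f),
      (forall f g, L f -> L g -> (forall x, `|f x| <= `|g x|) -> c f <= c g) &
      (forall fn : nat -> T -> R, (forall n, L (fn n)) ->
         (forall n x, fn n.+1 x <= fn n x) ->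
         (forall x, (fun n => fn n x) @ \oo --> (0 : R)) ->
         ereal_inf [set (c (fn n))%:E | n in setT] = 0%E)].

Definition c_lsc (L : set (T -> R)) (c : (T -> R) -> R) (f : T -> \bar R) : \bar R :=
  ereal_sup [set (c phi)%:E | phi in
    [set phi | L phi /\ forall x, 0 <= phi x /\ ((phi x)%:E <= f x)%E]].

Definition cext (L : set (T -> R)) (c : (T -> R) -> R) (g : T -> R) : \bar R :=
  ereal_inf [set c_lsc L c f | f in
    [set f : T -> \bar R | lower_semicontinuous f /\
                           forall x, ((`|g x|)%:E <= f x)%E]].

(* \mathcal L^1(c): closure of L in {g | c(g) < oo}.  Elements of the
   quotient L^1(c) are represented by their representatives g with
   L1 L c g; two representatives are identified when cext (g - h) = 0. *)
Definition L1 L c (g : T -> R) :=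
  (cext L c g < +oo)%E /\
  forall e : R, 0 < e -> exists2 phi, L phi & (cext L c (g \- phi)%R < e%:E)%E.

Definition L1_nonneg L c (g : T -> R) :=
  exists fn : nat -> T -> R, (forall n, L (fn n) /\ forall x, 0 <= fn n x) /\
    forall g', L1 L c g' -> cext L c (g' \- g)%R = 0%E ->
      (fun n => cext L c (g' \- fn n)%R) @ \oo --> 0%E.

Definition L1_le L c (X Y : T -> R) := L1_nonneg L c (Y \- X).

Definition prokhorov (L : set (T -> R)) (c : (T -> R) -> R) :=
  forall e : R, 0 < e -> exists K : set T, compact K /\
    forall f, L f -> (forall x, `|f x| <= \1_(~` K) x) -> c f <= e.

(* a map on L^1(c) (given on representatives, compatible with the quotient) *)
Definition L1_map L c (F : (T -> R) -> R) :=
  forall X Y, L1 L c X -> L1 L c Y -> cext L c (X \- Y)%R = 0%E -> F X = F Y.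

Definition L1_continuous L c (F : (T -> R) -> R) :=
  forall X, L1 L c X -> forall e : R, 0 < e -> exists2 d : R, 0 < d &
    forall Y, L1 L c Y -> (cext L c (Y \- X)%R < d%:E)%E -> `|F Y - F X| < e.

Definition convex_risk_measure L c (rho : (T -> R) -> R) :=
  [/\ L1_map L c rho,
      (forall X Y, L1 L c X -> L1 L c Y -> L1_le L c X Y -> rho Y <= rho X),
      (forall X Y (l : R), L1 L c X -> L1 L c Y -> 0 <= l <= 1 ->
         rho (fun x => l * X x + (1 - l) * Y x) <= l * rho X + (1 - l) * rho Y) &
      (forall X (a : R), L1 L c X -> rho (fun x => X x + a) = rho X - a)].

Definition borel := g_sigma_algebraType (@open T).

Definition dual_ext L c (Q : probability borel R) (l : (T -> R) -> R) :=
  [/\ (forall phi, L phi -> l phi = \int[Q]_x phi x),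
      L1_map L c l,
      (forall X Y (a b : R), L1 L c X -> L1 L c Y ->
         l (fun x => a * X x + b * Y x) = a * l X + b * l Y) &
      L1_continuous L c l].

Definition in_dual L c (Q : probability borel R) := exists l, dual_ext L c Q l.

Definition EQ L c (Q : probability borel R) (X : T -> R) : R :=
  xget 0 [set r | exists l, dual_ext L c Q l /\ r = l X].

Definition alpha L c (rho : (T -> R) -> R) (Q : probability borel R) : \bar R :=
  ereal_sup [set ((EQ L c Q (fun x => - X x))%:E - (rho X)%:E)%E | X in L1 L c].

End Defs.

(* Main.v *)
Require Import Defs.
From HB Require Import structures.
From mathcomp Require Import all_boot all_order all_algebra.
From mathcomp Require Import all_classical all_reals all_analysis.
From mathcomp Require Import measurable_realfun ring lra.
Set Implicit Arguments. Unset Strict Implicit. Unset Printing Implicit Defensive.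
Import Order.TTheory GRing.Theory Num.Theory.
Import numFieldNormedType.Exports.
Local Open Scope classical_set_scope.
Local Open Scope ring_scope.

(* A monotone finite convex function on the complete lattice [L^1(c)] is
   continuous: otherwise it blows up along a sequence with summable norms, and
   such a sequence has a common bound in [L^1(c)], by countable subadditivity of
   the extended capacity.  Hahn-Banach then gives a subgradient of
   [Y |-> rho (- Y)] at each point; monotonicity makes it positive and
   translation invariance gives it mass one.  By the axiom [c(f_n) -> 0] for
   [f_n] decreasing to [0], its restriction to [L] satisfies the Daniell
   condition, hence is integration against a Borel probability.  The
   corresponding outer measure of [A] is again the extension [cext] of a
   capacity, namely [f |-> l |f|], evaluated at the indicator of [A]. *)

(** * Lower semicontinuous functions as suprema in [L] *)

Lemma lte_dense (R : realFieldType) (a : R) (y : \bar R) : (a%:E < y)%E ->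
  exists2 b : R, a < b & (b%:E < y)%E.
Proof.
case: y => [r|_|//]; last by exists (a + 1); rewrite ?ltrDl ?ltry.
by rewrite lte_fin => ar; exists ((a + r) / 2); rewrite ?lte_fin ?midf_lt.
Qed.

Section LowerSemicontinuousApproximation.
Variables (R : realType) (T : ptopologicalType) (L : set (T -> R)).

(** The basis consists of the balls of radius [1/(j+1)] centred at points of a countable dense set,
    indexed by pairs of codes. *)
Lemma metrizable_separable_basis :
  metrizable R T -> separable T ->
  exists B : nat -> set T, (forall n, open (B n)) /\
    forall (A : set T) x, open A -> A x -> exists n, B n x /\ B n `<=` A.
Proof.
move=> [d [d0 [dE [dC [dT dO]]]]] [D [/countable_injP[f finj] clD]].
pose ball q (r : R) := [set y | d q y < r].
have ballO q r : open (ball q r).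
  apply/dO => x /= qx; exists (r - d q x); first by rewrite subr_gt0.
  by move=> y /=; rewrite ltrBrDl; exact/le_lt_trans/dT.
(* Countability of [D] is given by an injection [f] into the naturals, so the centre with code [i]
   is recovered as a union over all [q] in [D] with [f q = i]: one ball, or the empty set if [i]
   codes no point. *)
pose B n := if unpickle n is Some (i, j)
  then \bigcup_(q in [set q : T | D q /\ f q = i]) ball q (j.+1%:R^-1)
  else set0.
exists B; split.
  move=> n; rewrite /B; case: (unpickle n) => [[i j]|]; last exact: open0.
  by apply: bigcup_open => q _; exact: ballO.
move=> A x oA Ax.
have /dO/(_ x Ax)[e e0 eA] := oA.
have e20 : 0 < e / 2 by rewrite divr_gt0.
have [j] := ltr_add_invr e20; rewrite add0r => je.
have nx : nbhs x (ball x j.+1%:R^-1).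
  apply: open_nbhs_nbhs; split; first exact: ballO.
  by rewrite /ball /= (dE x x).2 // invr_gt0.
have : closure D x by rewrite clD.
move=> /(_ _ nx)[q [Dq /= xq]].
exists (pickle (f q, j)); rewrite /B pickleK; split.
  by exists q => //=; rewrite /ball /= dC.
move=> y [q' [Dq' /finj]]; rewrite !inE => -> // qy.
apply: eA => /=; apply: le_lt_trans (dT x q y) _.
by rewrite (splitr e) ltrD // (lt_trans _ je).
Qed.

Hypothesis HL : vector_lattice_Cb L.

Lemma Cb_bounded_continuous f : L f -> bounded_continuous f.
Proof. by case: HL => + _; exact. Qed.

Lemma latticeD f g : L f -> L g -> L (fun x => f x + g x).
Proof. by case: HL => _ [+ _]; exact. Qed.

Lemma latticeZ (a : R) f : L f -> L (fun x => a * f x).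
Proof. by case: HL => _ [_ [+ _]]; exact. Qed.

Lemma lattice_max f g : L f -> L g -> L (fun x => Num.max (f x) (g x)).
Proof. by case: HL => _ [_ [_ [+ _]]]; exact. Qed.

Lemma lattice_cst a : L (fun=> a).
Proof. by case: HL => _ [_ [_ [_]]]; exact. Qed.

Lemma latticeN f : L f -> L (fun x => - f x).
Proof. by move=> /(latticeZ (-1)); under eq_fun do rewrite mulN1r. Qed.

Lemma latticeB f g : L f -> L g -> L (fun x => f x - g x).
Proof. by move=> Lf /latticeN; exact: latticeD. Qed.

Lemma lattice_norm f : L f -> L (fun x => `|f x|).
Proof.
move=> Lf; have := lattice_max Lf (latticeN Lf).
by under eq_fun do rewrite maxrN.
Qed.

(** The maximum [g] of the finitely many functions [|fs i y - fs i x|] belongs to [L], vanishes at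
    [x] and is below [e] only inside [U]. The bump is then [b * max 0 (1 - g / e)]. *)
Lemma lattice_bump (U : set T) x (b : R) : generates_topology L -> open U -> U x ->
  0 <= b -> exists2 phi, L phi &
    phi x = b /\ forall y, 0 <= phi y <= b /\ (~ U y -> phi y = 0).
Proof.
move=> gL oU Ux b0; have [n [fs [e [e0 Lfs fsU]]]] := gL U x oU Ux.
have [g [Lg g0 gx ge]] : exists g : T -> R, [/\ L g, forall y, 0 <= g y, g x = 0 &
    forall y, g y < e -> forall i, (i < n)%N -> `|fs i y - fs i x| < e].
  elim: n {fsU} Lfs => [|n IH] Lfs; first by exists (fun=> 0); split => //; exact: lattice_cst.
  have [i /ltnW/Lfs //|g [Lg g0 gx ge]] := IH.
  exists (fun y => Num.max (g y) `|fs n y - fs n x|); split.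
  - apply/lattice_max/lattice_norm/latticeB => //; first exact: Lfs.
    exact: lattice_cst.
  - by move=> y; rewrite le_max g0.
  - by rewrite subrr normr0 gx maxxx.
  move=> y; rewrite gt_max => /andP[gy fy] i.
  by rewrite ltnS leq_eqVlt => /orP[/eqP->//|]; exact: ge.
exists (fun y => b * Num.max 0 (1 - e^-1 * g y)).
  apply/latticeZ/lattice_max; first exact: lattice_cst.
  by apply: latticeB; [exact: lattice_cst|exact: latticeZ].
rewrite gx mulr0 subr0 (max_idPr _)// mulr1; split => // y; split.
  rewrite mulr_ge0 ?le_max ?lexx//= ler_piMr // ge_max ler01 /=.
  by rewrite gerBl mulr_ge0 // invr_ge0 ltW.
move=> Uy; rewrite (max_idPl _) ?mulr0 // subr_le0 -ler_pdivrMl ?invr_gt0//.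
rewrite invrK mulr1 leNgt; apply/negP => /ge/fsU; exact: Uy.
Qed.

(* Basis sets and rational levels index the countably many lattice functions
   whose supremum is [f]. *)
Lemma lsc_sup_lattice f : metrizable R T -> separable T -> generates_topology L ->
  lower_semicontinuous f -> (forall x, (0 <= f x)%E) ->
  exists u : nat -> T -> R, [/\ forall n, L (u n),
    forall n x, 0 <= u n x /\ ((u n x)%:E <= f x)%E,
    forall n x, u n x <= u n.+1 x &
    forall x (a : R), (a%:E < f x)%E -> exists n, a < u n x].
Proof.
move=> mT sT gL lf f0.
have [B [oB Bx]] := metrizable_separable_basis mT sT.
pose P n := [set phi | [/\ L phi, forall x, 0 <= phi x /\ ((phi x)%:E <= f x)%E &
  if unpickle n is Some (i, q) then forall x, B i x -> ratr (q : rat) < phi x else True]].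
(* If no lattice minorant of [f] exceeds [q] on [B i], the default [0] is taken, which is still a
   minorant because [f] is nonnegative. *)
pose v n := xget (fun=> 0) (P n).
have vP n : L (v n) /\ forall x, 0 <= v n x /\ ((v n x)%:E <= f x)%E.
  rewrite /v; case: xgetP => [phi _ []//|_].
  by split => //; exact: lattice_cst.
pose u := fix u n := if n is m.+1 then fun x => Num.max (u m x) (v m.+1 x) else v 0.
have vu n x : v n x <= u n x by case: n => //= n; rewrite le_max lexx orbT.
exists u; split.
- by elim=> [|n IH] /=; [exact: (vP 0).1|apply: lattice_max => //; exact: (vP _).1].
- elim=> [|n IH] x /=; first exact: (vP 0).2.
  rewrite le_max (IH x).1 /=; split => //.
  by case: (leP (u n x) (v n.+1 x)) => _; [exact: ((vP _).2 x).2|exact: (IH x).2].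
- by move=> n x /=; rewrite le_max lexx.
move=> x a afx; have [a0|a0] := ltP a 0.
  by exists 0; apply: (lt_le_trans a0); exact: ((vP 0).2 x).1.
have [b ab bfx] := lte_dense afx.
have b0 := le_trans a0 (ltW ab).
(* A bump of height [b] supported in the open set where [f > b] lies below [f]. It exceeds a
   rational [q] between [a] and [b] on a basis set around [x], so the corresponding [P n] is
   inhabited. *)
have oU : open [set y | (b%:E < f y)%E] by exact: (lower_semicontinuousP f).1 lf b.
have [phi Lphi [phix phiP]] := lattice_bump gL oU bfx b0.
have [q] := rat_in_itvoo ab; rewrite in_itv/= => /andP[aq qb].
have oV : open [set y | ratr q < phi y].
  have /continuousP cphi := (Cb_bounded_continuous Lphi).1.
  exact: (cphi _ (@open_gt R (ratr q))).
have [|i [Bix BiV]] := Bx _ x oV; first by rewrite /= phix.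
pose n := pickle (i, q).
have : P n (v n).
  apply: xgetPex; exists phi; split => //; last by rewrite /n pickleK => y /BiV.
  move=> y; have [/andP[p0 pb] pU] := phiP y; split => //.
  have [yU|/negP yU] := boolP (b%:E < f y)%E; last by rewrite pU.
  by apply: (le_trans _ (ltW yU)); rewrite lee_fin.
case=> _ _; rewrite /n pickleK => /(_ x Bix) qv.
by exists n; exact/(lt_trans aq)/(lt_le_trans qv).
Qed.

End LowerSemicontinuousApproximation.

(** * Extended capacities and [L^1(c)] *)

Section ExtendedSums.
Variable R : realType.

Lemma lte_addP (a : R) (s t : \bar R) : (0 <= s -> 0 <= t -> a%:E < s + t ->
  exists b1 b2 : R, [/\ b1%:E < s, b2%:E < t & (a <= b1 + b2)%R])%E.
Proof.
case: s => [s| |]//; case: t => [t| |]// s0 t0 ast.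
- exists (s - (s + t - a) / 2), (t - (s + t - a) / 2).
  by move: ast; rewrite !lte_fin => ast; split; lra.
- by exists (s - 1), (a - s + 1); rewrite lte_fin ltry; split => //; lra.
- by exists (a - t + 1), (t - 1); rewrite lte_fin ltry; split => //; lra.
- by exists a, 0; rewrite !ltry addr0.
Qed.

Lemma lt_nneseries (u : nat -> \bar R) (a : \bar R) : ((forall n, 0 <= u n) ->
  a < \sum_(n <oo) u n -> exists m, a < \sum_(k < m) u k)%E.
Proof.
move=> u0 au; apply: contrapT => /forallNP h.
move: au; apply/negP; rewrite -leNgt.
apply: lime_le; first by apply: is_cvg_nneseries => n _ _.
apply: nearW => m; rewrite big_mkord leNgt; apply/negP; exact: h.
Qed.

(** A sum of two terms is written as a series so that the triangle inequality for [cext] becomes a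
    case of countable subadditivity. *)
Lemma nneseries2 (a b : \bar R) : (0 <= a -> 0 <= b ->
  \sum_(n <oo) (if n is m.+1 then if m is 0%N then b else 0 else a) = a + b)%E.
Proof.
move=> a0 b0; rewrite (nneseries_split 0 2); last by move=> [|[|k]] _.
rewrite eseries0 ?adde0; last by move=> [|[|k]].
by rewrite add0n big_mkord !big_ord_recl big_ord0 adde0.
Qed.

End ExtendedSums.

(** * Sums of nonnegative lower semicontinuous functions *)

Section LowerSemicontinuousSums.
Variables (R : realType) (T : topologicalType).
Implicit Types f g : T -> \bar R.
Local Open Scope ereal_scope.

Lemma lsc_add f g : (forall x, 0 <= f x) -> (forall x, 0 <= g x) ->
  lower_semicontinuous f -> lower_semicontinuous g ->
  lower_semicontinuous (fun x => f x + g x).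
Proof.
move=> f0 g0 lf lg x a /lte_addP[//|//|b1 [b2 [/lf[V nV Vf] /lg[W nW Wg] ab]]].
exists (V `&` W); first exact: filterI.
move=> y [/Vf fy /Wg gy]; apply: (@le_lt_trans _ _ (b1 + b2)%:E).
  by rewrite lee_fin.
by rewrite EFinD; exact: lteD.
Qed.

Lemma lsc_sum (f : nat -> T -> \bar R) m : (forall n x, 0 <= f n x) ->
  (forall n, lower_semicontinuous (f n)) ->
  lower_semicontinuous (fun x => \sum_(k < m) f k x).
Proof.
move=> f0 lf; elim: m => [|m IH].
  under eq_fun do rewrite big_ord0.
  by move=> x a a0; exists setT => //; exact: filterT.
under eq_fun do rewrite big_ord_recr /=.
by apply: lsc_add => // x; exact: sume_ge0.
Qed.

Lemma lsc_nneseries (f : nat -> T -> \bar R) : (forall n x, 0 <= f n x) ->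
  (forall n, lower_semicontinuous (f n)) ->
  lower_semicontinuous (fun x => \sum_(k <oo) f k x).
Proof.
move=> f0 lf x a /lt_nneseries[//|m /(lsc_sum f0 lf)[V nV Vf]].
exists V => // y /Vf /lt_le_trans; apply.
by rewrite -(big_mkord xpredT (fun k => f k y)); exact: nneseries_lim_ge.
Qed.

End LowerSemicontinuousSums.

(** * The extended capacity and its countable subadditivity *)

Section Capacity.
Variables (R : realType) (T : ptopologicalType) (L : set (T -> R)).
Variable c : (T -> R) -> R.
Hypotheses (HL : vector_lattice_Cb L) (Hc : capacity L c).
Hypotheses (mT : metrizable R T) (sT : separable T) (gL : generates_topology L).

Lemma capacityD f g : L f -> L g -> c (fun x => f x + g x) <= c f + c g.
Proof. by case: Hc => + _ _ _; exact. Qed.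

Lemma capacityZ a f : L f -> c (fun x => a * f x) = `|a| * c f.
Proof. by case: Hc => _ + _ _; exact. Qed.

Lemma le_capacity f g : L f -> L g -> (forall x, `|f x| <= `|g x|) -> c f <= c g.
Proof. by case: Hc => _ _ + _; exact. Qed.

Lemma capacity0 : c (fun=> 0) = 0.
Proof.
by have := capacityZ 0 (lattice_cst HL 0); rewrite normr0 !mul0r.
Qed.

Lemma capacity_norm f : L f -> c (fun x => `|f x|) = c f.
Proof.
move=> Lf; have Lnf := lattice_norm HL Lf.
by apply/eqP; rewrite eq_le !le_capacity// => x; rewrite normr_id.
Qed.

Lemma capacity_decreasing fn : (forall n, L (fn n)) ->
  (forall n x, fn n.+1 x <= fn n x) ->
  (forall x, (fun n => fn n x) @ \oo --> (0 : R)) ->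
  forall e, 0 < e -> exists n, c (fn n) < e.
Proof.
move=> Lf df cf e e0; case: Hc => _ _ _ /(_ fn Lf df cf) inf0.
have : (ereal_inf [set (c (fn n))%:E | n in setT] < e%:E)%E by rewrite inf0 lte_fin.
by move/ereal_inf_lt => [_ [n _ <-]]; rewrite lte_fin; exists n.
Qed.

Lemma lattice_sum n (g : nat -> T -> R) : (forall k, L (g k)) ->
  L (fun x => \sum_(k < n) g k x).
Proof.
move=> Lg; elim: n => [|n IH].
  by under eq_fun do rewrite big_ord0; exact: lattice_cst.
by under eq_fun do rewrite big_ord_recr; exact: latticeD.
Qed.

Lemma capacity_sum n (g : nat -> T -> R) : (forall k, L (g k)) ->
  c (fun x => \sum_(k < n) g k x) <= \sum_(k < n) c (g k).
Proof.
move=> Lg; elim: n => [|n IH].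
  by under eq_fun do rewrite big_ord0; rewrite big_ord0 capacity0.
under eq_fun do rewrite big_ord_recr; rewrite big_ord_recr /=.
by apply: le_trans (capacityD (lattice_sum _ Lg) (Lg n)) _; rewrite lerD2r.
Qed.

Local Open Scope ereal_scope.

Lemma c_lsc_ub phi f : L phi -> (forall x, (0 <= phi x)%R /\ (phi x)%:E <= f x) ->
  (c phi)%:E <= c_lsc L c f.
Proof. by move=> Lp pf; apply: ereal_sup_ubound; exists phi. Qed.

Lemma c_lsc_ge0 f : (forall x, 0 <= f x) -> 0 <= c_lsc L c f.
Proof.
move=> f0; apply: (le_trans _ (c_lsc_ub (lattice_cst HL 0) _)) => //.
by rewrite capacity0.
Qed.

(** Let [phi] in [L] lie below the sum, and let [u k n] in [L] increase to [f k] as [n] grows. The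
    positive part [psi n] of [phi - s n], where [s n] sums [u k n] over [k < n], decreases to [0],
    so the capacity axiom makes [c (psi n)] small, while [c phi <= c (s n) + c (psi n)] and
    [c (s n)] is bounded by the series. *)
Lemma c_lsc_nneseries (f : nat -> T -> \bar R) : (forall n x, 0 <= f n x) ->
  (forall n, lower_semicontinuous (f n)) ->
  c_lsc L c (fun x => \sum_(n <oo) f n x) <= \sum_(n <oo) c_lsc L c (f n).
Proof.
move=> f0 lf.
have /choice[u uP] := fun n => lsc_sup_lattice HL mT sT gL (lf n) (f0 n).
have Lu k n : L (u k n) by case: (uP k).
have u0 k n x : (0 <= u k n x)%R by case: (uP k) => _ /(_ n x)[].
have uf k n x : (u k n x)%:E <= f k x by case: (uP k) => _ /(_ n x)[].
have um k x : {homo u k ^~ x : m n / (m <= n)%N >-> (m <= n)%R}.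
  by apply: homo_leq => // [y z t|n]; [exact: le_trans|by case: (uP k) => _ _ + _; exact].
have us m x a : a%:E < \sum_(k < m) f k x -> exists n, (a < \sum_(k < m) u k n x)%R.
  elim: m a => [|m IH] a; first by rewrite big_ord0 lte_fin => a0; exists 0%N; rewrite big_ord0.
  rewrite big_ord_recr /= => /lte_addP[||b1 [b2 [/IH[n1 h1] h2 ab]]] //.
    exact: sume_ge0.
  have [n2 {}h2] : exists n, (b2 < u m n x)%R by case: (uP m) => _ _ _; exact.
  exists (maxn n1 n2); rewrite big_ord_recr /=; apply: (le_lt_trans ab); apply: ltrD.
    by apply: (lt_le_trans h1); apply: ler_sum => k _; exact: um (leq_maxl _ _).
  by apply: (lt_le_trans h2); exact: um (leq_maxr _ _).
apply: ge_ereal_sup => _ [phi [Lphi phif] <-].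
(* In this diagonal sum the number of terms and the level of approximation grow together; it
   increases because the [u k n] are nonnegative and increasing in [n]. *)
pose s n x := (\sum_(k < n) u k n x)%R.
have Ls n : L (s n) := lattice_sum n (fun k => Lu k n).
have sm x : {homo s ^~ x : m n / (m <= n)%N >-> (m <= n)%R}.
  apply: homo_leq => // [y z t|n]; first exact: le_trans.
  rewrite /s big_ord_recr /= -[leLHS]addr0 lerD// ler_sum// => k _.
  exact: um.
pose psi n x := Num.max (phi x - s n x)%R 0%R.
have Lpsi n : L (psi n).
  by apply: lattice_max => //; [exact: latticeB|exact: lattice_cst].
apply/lee_addgt0Pr => e e0.
have [| |n ne] := @capacity_decreasing psi Lpsi _ _ e e0.
- move=> n x; rewrite /psi ge_max !le_max lexx orbT andbT lerD2l lerN2.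
  by rewrite sm.
- move=> x; apply/cvgrPdist_lt => d d0.
  have [m mP] : exists m, ((phi x - d)%R%:E < \sum_(k < m) f k x).
    apply: (@lt_nneseries _ (f ^~ x)) => //; apply: lt_le_trans (phif x).2.
    by rewrite lte_fin; lra.
  have [n nP] := us _ _ _ mP.
  exists (maxn m n) => // N /=; rewrite geq_max => /andP[mN nN].
  rewrite sub0r normrN ger0_norm ?le_max ?lexx ?orbT // gt_max d0 andbT.
  suff : (phi x - d < s N x)%R by lra.
  apply: (lt_le_trans nP); apply: (@le_trans _ _ (\sum_(k < m) u k N x)%R).
    by apply: ler_sum => k _; exact: um.
  rewrite /s -!(big_mkord xpredT (fun k => u k N x)) (big_cat_nat (leq0n m) mN)/=.
  by rewrite lerDl sumr_ge0.
have cphi : (c phi <= c (s n) + c (psi n))%R.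
  apply: le_trans (capacityD (Ls n) (Lpsi n)); apply: le_capacity => //.
    exact: latticeD.
  move=> x; rewrite ger0_norm; last exact: (phif x).1.
  by apply: le_trans (ler_norm _); rewrite -lerBlDl le_max lexx.
apply: (@le_trans _ _ ((c (s n))%:E + (c (psi n))%:E)); first by rewrite -EFinD lee_fin.
apply: leeD; last by rewrite lee_fin ltW.
apply: (@le_trans _ _ (\sum_(k < n) (c (u k n))%:E)).
  by rewrite sumEFin lee_fin; exact: (capacity_sum n (fun k => Lu k n)).
apply: (@le_trans _ _ (\sum_(k < n) c_lsc L c (f k))).
  by apply: lee_sum => k _; apply: c_lsc_ub.
rewrite -(big_mkord xpredT (fun k => c_lsc L c (f k))).
by apply: nneseries_lim_ge => k _ _; exact: c_lsc_ge0.
Qed.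

Lemma le_cext g h : (forall x, `|g x| <= `|h x|)%R -> cext L c g <= cext L c h.
Proof.
move=> gh; apply: ereal_inf_le_tmp => _ [f [lf hf] <-]; exists f => //; split => // x.
by apply: le_trans (hf x); rewrite lee_fin.
Qed.

Lemma cext_ge0 g : 0 <= cext L c g.
Proof.
apply: le_ereal_inf_tmp => _ [f [lf gf] <-]; apply: c_lsc_ge0 => x.
by apply: le_trans (gf x); rewrite lee_fin.
Qed.

Lemma cext_le_c_lsc g f : lower_semicontinuous f -> (forall x, `|g x|%:E <= f x) ->
  cext L c g <= c_lsc L c f.
Proof. by move=> lf gf; apply: ereal_inf_lbound; exists f. Qed.

(** By continuity [|phi|] is itself an admissible lower semicontinuous majorant; conversely [|phi|]
    competes in the supremum defining [c_lsc] of any majorant. *)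
Lemma cext_lattice phi : L phi -> cext L c phi = (c phi)%:E.
Proof.
move=> Lp; rewrite -(capacity_norm Lp); have Lnp := lattice_norm HL Lp.
apply/eqP; rewrite eq_le; apply/andP; split; last first.
  apply: le_ereal_inf_tmp => _ [f [lf pf] <-].
  by apply: c_lsc_ub => // x; split.
apply: (le_trans (@cext_le_c_lsc _ (fun x => `|phi x|%:E) _ _)) => //.
  move=> x a; rewrite lte_fin => ap; exists [set y | a < `|phi y|]%R => //.
  have /continuousP cphi := (Cb_bounded_continuous HL Lnp).1.
  by apply: open_nbhs_nbhs; split => //; exact: cphi _ (@open_gt R a).
apply: ge_ereal_sup => _ [psi [Lpsi psip] <-]; rewrite lee_fin.
by apply: le_capacity => // x; rewrite ger0_norm ?normr_id; case: (psip x).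
Qed.

(** If all terms are finite, choose lower semicontinuous majorants of the [|h n|] that are optimal
    up to [e / 2^(n+1)]. Their sum is a lower semicontinuous majorant of [|g|], and
    [c_lsc_nneseries] applies to it. *)
Lemma cext_nneseries g (h : nat -> T -> R) :
  (forall x, `|g x|%:E <= \sum_(n <oo) `|h n x|%:E) ->
  cext L c g <= \sum_(n <oo) cext L c (h n).
Proof.
move=> gh.
have [[n hn]|hfin] := pselect (exists n, cext L c (h n) = +oo).
  by rewrite (nneseries_pinfty _ _ hn) ?leey// => k _; exact: cext_ge0.
have fin n : cext L c (h n) \is a fin_num.
  rewrite ge0_fin_numE ?cext_ge0// lt_neqAle leey andbT; apply/eqP => hn.
  by apply: hfin; exists n.
apply/lee_addgt0Pr => e e0.
have : forall n, exists f, [/\ lower_semicontinuous f, forall x, `|h n x|%:E <= f x &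
    c_lsc L c f <= cext L c (h n) + (e / (2 ^ n.+1)%:R)%:E].
  move=> n; have e2 : (0 < e / (2 ^ n.+1)%:R)%R.
    by rewrite divr_gt0// ltr0n expn_gt0.
  have [_ [f [lf hf] <-] /ltW fe] := lb_ereal_inf_adherent e2 (fin n).
  by exists f.
move=> /choice[f fP].
have lf n : lower_semicontinuous (f n) by case: (fP n).
have hf n x : `|h n x|%:E <= f n x by case: (fP n).
have f0 n x : 0 <= f n x by apply: le_trans (hf n x); rewrite lee_fin.
apply: le_trans (epsilon_trick _ _ (ltW e0)); last by move=> n; exact: cext_ge0.
apply: (@le_trans _ _ (\sum_(n <oo) c_lsc L c (f n))); last first.
  apply: lee_nneseries => [n _ _|n _]; first exact: c_lsc_ge0.
  by case: (fP n).
apply: le_trans (c_lsc_nneseries f0 lf).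
apply: cext_le_c_lsc; first exact: lsc_nneseries.
by move=> x; apply: (le_trans (gh x)); apply: lee_nneseries.
Qed.

Lemma cext0 : cext L c (fun=> 0%R)%R = 0.
Proof. by rewrite cext_lattice ?capacity0 //; exact: lattice_cst. Qed.

Lemma cext_triangle g h k : (forall x, `|g x| <= `|h x| + `|k x|)%R ->
  cext L c g <= cext L c h + cext L c k.
Proof.
move=> ghk; rewrite -nneseries2 ?cext_ge0//.
pose s n := if n is m.+1 then if m is 0%N then k else fun=> 0%R else h.
rewrite (@eq_eseriesr _ _ (fun n => cext L c (s n))).
  apply: cext_nneseries => x.
  rewrite (@eq_eseriesr _ _ (fun n => if n is m.+1 then
    if m is 0%N then `|k x|%:E else 0 else `|h x|%:E)).
    by rewrite nneseries2// -EFinD lee_fin.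
  by move=> [|[|n]] //= _; rewrite normr0.
by move=> [|[|n]] //= _; rewrite cext0.
Qed.

(** With a natural factor, induction on the triangle inequality suffices; real factors are later
    rounded up to natural ones. *)
Lemma cext_natmul n g h : (forall x, `|g x| <= n%:R * `|h x|)%R ->
  cext L c g <= n%:R%:E * cext L c h.
Proof.
elim: n g => [|n IH] g gh.
  rewrite mul0e -cext0; apply: le_cext => x.
  by have := gh x; rewrite mul0r normr0.
apply: (@le_trans _ _ (cext L c (fun x => n%:R * h x)%R + cext L c h)).
  apply: cext_triangle => x; rewrite normrM normr_nat.
  by rewrite -[X in (_ + X)%R]mul1r -mulrDl natr1.
rewrite -natr1 EFinD ge0_muleDl ?lee_fin// mul1e leeD2r//.
by apply: IH => x; rewrite normrM normr_nat.
Qed.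

Lemma cext_sum n (h : nat -> T -> R) :
  cext L c (fun x => \sum_(k < n) h k x)%R <= \sum_(k < n) cext L c (h k).
Proof.
elim: n => [|n IH].
  by rewrite big_ord0; under eq_fun do rewrite big_ord0; rewrite cext0.
rewrite big_ord_recr /=; apply: le_trans (leeD2r _ IH).
by apply: cext_triangle => x; rewrite big_ord_recr; exact: ler_normD.
Qed.

Local Close Scope ereal_scope.

(** * The space $L^1(c)$, its lattice operations and its order *)

Lemma L1_lattice phi : L phi -> L1 L c phi.
Proof.
move=> Lp; split; first by rewrite cext_lattice ?ltry.
move=> e e0; exists phi => //.
have -> : phi \- phi = fun=> 0 by apply/funext => x /=; rewrite subrr.
by rewrite cext0 lte_fin.
Qed.

(** Approximations by elements of [L1] are replaced by approximations in [L] at half the tolerance.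
    Finiteness of [cext L c X] then follows from a single function of [L] at distance less than
    [1]. *)
Lemma L1_approx (X : T -> R) : (forall e : R, 0 < e ->
  exists2 Y, L1 L c Y & (cext L c (fun x => X x - Y x)%R < e%:E)%E) -> L1 L c X.
Proof.
move=> XY; have XL e : 0 < e -> exists2 phi, L phi & (cext L c (fun x => X x - phi x)%R < e%:E)%E.
  move=> e0; have e20 : 0 < e / 2 by rewrite divr_gt0.
  have [Y [_ /(_ _ e20)[phi Lp Yp]] XYe] := XY _ e20; exists phi => //.
  rewrite (splitr e) EFinD; apply: le_lt_trans (lteD XYe Yp).
  apply: cext_triangle => x /=; apply: le_trans (ler_normD _ _).
  by rewrite addrA subrK.
split => //; have [phi Lp Xp] := XL 1 ltr01.
apply: (@le_lt_trans _ _ (cext L c (fun x => X x - phi x)%R + cext L c phi)%E).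
  apply: cext_triangle => x; apply: le_trans (ler_normD _ _).
  by rewrite subrK.
rewrite (cext_lattice Lp); apply: lte_add_pinfty; last exact: ltry.
exact: lt_trans Xp (ltry _).
Qed.

Lemma L1D X Y : L1 L c X -> L1 L c Y -> L1 L c (fun x => X x + Y x).
Proof.
move=> [_ LX] [_ LY]; apply: L1_approx => e e0.
have e20 : 0 < e / 2 by rewrite divr_gt0.
have [phi Lp Xp] := LX _ e20; have [psi Lq Yq] := LY _ e20.
exists (fun x => phi x + psi x); first exact: L1_lattice (latticeD HL Lp Lq).
rewrite (splitr e) EFinD; apply: le_lt_trans (lteD Xp Yq).
apply: cext_triangle => x /=; apply: le_trans (ler_normD _ _).
by rewrite opprD addrACA.
Qed.

(** This treats scalar multiplication and absolute value at once: if [phi] approximates [X], then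
    [F \o phi] approximates [F \o X], up to the Lipschitz constant. *)
Lemma L1_lipschitz (F : R -> R) X : (forall phi, L phi -> L (F \o phi)) ->
  (exists n : nat, forall a b, `|F a - F b| <= n%:R * `|a - b|) ->
  L1 L c X -> L1 L c (F \o X).
Proof.
move=> LF [n Fn] [_ LX]; apply: L1_approx => e e0.
have n0 : 0 < n.+1%:R :> R by rewrite ltr0n.
have [phi Lp Xp] := LX _ (divr_gt0 e0 n0).
exists (F \o phi); first exact: L1_lattice (LF _ Lp).
apply: (@le_lt_trans _ _ (n.+1%:R%:E * cext L c (X \- phi)%R)%E).
  apply: cext_natmul => x; apply: (le_trans (Fn _ _)).
  by rewrite ler_wpM2r// ler_nat.
by rewrite muleC -lte_pdivlMr// mulrC EFinM.
Qed.

Lemma L1Z a X : L1 L c X -> L1 L c (fun x => a * X x).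
Proof.
apply: (@L1_lipschitz ( *%R a)) => [phi|]; first exact: latticeZ.
exists (Num.bound `|a|) => x y; rewrite -mulrBr normrM ler_wpM2r//.
by rewrite ltW// archi_boundP.
Qed.

Lemma L1N X : L1 L c X -> L1 L c (fun x => - X x).
Proof. by move=> /(L1Z (-1)); under eq_fun do rewrite mulN1r. Qed.

Lemma L1B X Y : L1 L c X -> L1 L c Y -> L1 L c (fun x => X x - Y x).
Proof. by move=> LX /L1N; exact: L1D. Qed.

Lemma L1_norm X : L1 L c X -> L1 L c (fun x => `|X x|).
Proof.
apply: (@L1_lipschitz Num.norm) => [phi|]; first exact: lattice_norm.
by exists 1%N => x y; rewrite mul1r ler_dist_dist.
Qed.

Lemma L1_sum n (Y : nat -> T -> R) : (forall k, L1 L c (Y k)) ->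
  L1 L c (fun x => \sum_(k < n) Y k x).
Proof.
move=> LY; elim: n => [|n IH].
  by under eq_fun do rewrite big_ord0; exact: L1_lattice (lattice_cst HL 0).
by under eq_fun do rewrite big_ord_recr; exact: L1D.
Qed.

(** This passes from positivity off a null set to the order defined by approximation. The positive
    parts of lattice approximants of [X] converge to the positive part of [X], since taking positive
    parts is 1-Lipschitz, and [X] differs from its positive part by a null function. *)
Lemma L1_nonneg_neg_part X : L1 L c X ->
  cext L c (fun x => Num.min (X x) 0)%R = 0%E -> L1_nonneg L c X.
Proof.
move=> [_ LX] X0.
have /choice[phi phiP] : forall n, exists phi, L phi /\
    (cext L c (fun x => X x - phi x)%R < (n.+1%:R^-1)%:E)%E.
  by move=> n; have [|phi] := LX n.+1%:R^-1; [rewrite invr_gt0 ltr0n|exists phi].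
exists (fun n x => Num.max (phi n x) 0); split.
  move=> n; split; last by move=> x; rewrite le_max lexx orbT.
  by apply: lattice_max => //; [case: (phiP n)|exact: lattice_cst].
move=> g' _ g'X.
apply: (@squeeze_cvge _ _ _ _ (fun=> 0%E) _ (fun n => (n.+1%:R^-1)%:E)).
- apply: nearW => n; rewrite cext_ge0/=; apply: le_trans (ltW (phiP n).2).
  rewrite -[leRHS]add0e -g'X; apply: (@le_trans _ _ (cext L c (g' \- X)%R +
    cext L c (fun x => X x - Num.max (phi n x) 0)%R)%E).
    apply: cext_triangle => x /=; apply: le_trans (ler_normD _ _).
    by rewrite addrA subrK.
  apply: leeD2l; rewrite -[leRHS]add0e -X0; apply: cext_triangle => x.
  apply: (@le_trans _ _ (`|Num.min (X x) 0| + `|Num.max (X x) 0 - Num.max (phi n x) 0|)).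
    apply: le_trans (ler_normD _ _); rewrite addrA.
    by case: (leP (X x) 0) => _; rewrite ?addr0 ?add0r.
  rewrite lerD2l; case: (leP (X x) 0); case: (leP (phi n x) 0) => *;
    rewrite !ler_norml; apply/andP; split; have := ler_norm (X x - phi n x);
    have := ler_norm (- (X x - phi n x)); rewrite normrN; lra.
- exact: cvg_cst.
- apply/fine_cvgP; split; first by apply: nearW.
  exact: cvg_harmonic.
Qed.

(* Where the series diverges, [fine] makes the bound [0]; this happens on a set
   on which every tail of the series is infinite, hence a null set. *)
Lemma L1_upper_bound (Y : nat -> T -> R) : (forall n, L1 L c (Y n)) ->
  (\sum_(n <oo) cext L c (Y n) < +oo)%E ->
  exists2 Z, L1 L c Z & forall n, L1_le L c (Y n) Z.
Proof.
move=> LY Yoo; pose S x := (\sum_(n <oo) `|Y n x|%:E)%E.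
pose Z x := fine (S x).
(* Both claims about [Z] reduce to domination by tails of the series, whose capacities tend to
   [0]. *)
have cext_tail m g : (forall x, `|g x|%:E <= \sum_(m <= n <oo) `|Y n x|%:E)%E ->
    (cext L c g <= \sum_(m <= n <oo) cext L c (Y n))%E.
  move=> gY; rewrite -nneseries_addn; last by move=> i; exact: cext_ge0.
  by apply: cext_nneseries => x; rewrite (nneseries_addn (f := fun n => `|Y n x|%:E)).
have small e : 0 < e -> exists m, (\sum_(m <= n <oo) cext L c (Y n) < e%:E)%E.
  move=> e0; have := nneseries_tail_cvg Yoo (fun k _ => cext_ge0 (Y k)).
  move=> /fine_cvgP[fin /cvgrPdist_lt/(_ _ e0) lte].
  near \oo => m; exists m; have tfin : (\sum_(m <= n <oo) cext L c (Y n))%E \is a fin_num.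
    by near: m.
  rewrite -(fineK tfin) lte_fin; apply: le_lt_trans (ler_norm _) _.
  by rewrite -normrN -sub0r; near: m.
have SE m x : S x = ((\sum_(k < m) `|Y k x|)%:E + \sum_(m <= n <oo) `|Y n x|%:E)%E.
  by rewrite /S (nneseries_split 0 m)// add0n big_mkord sumEFin.
have tail0 m x : (0 <= \sum_(m <= n <oo) `|Y n x|%:E)%E by exact: nneseries_ge0.
have LZ : L1 L c Z.
  apply: L1_approx => e /small[m me].
  exists (fun x => \sum_(k < m) `|Y k x|).
    by apply: (@L1_sum m (fun k x => `|Y k x|)) => k; exact: L1_norm.
  apply: le_lt_trans me; apply: cext_tail => x.
  (* Where the tail is finite, it equals [Z] minus the partial sum; where it is infinite, it
     dominates trivially. *)
  rewrite /Z (SE m); case: (\sum_(m <= n <oo) _)%E (tail0 m x) => [t|_|//].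
    by rewrite !lee_fin => t0; rewrite /= addrAC subrr add0r ger0_norm.
  by rewrite leey.
exists Z => // n; apply: L1_nonneg_neg_part; first exact: L1B.
apply/eqP; rewrite eq_le cext_ge0 andbT; apply/lee_addgt0Pr => e /small[m me].
rewrite add0e; apply: le_trans (ltW me); apply: cext_tail => x.
have YS : (`|Y n x|%:E <= S x)%E.
  by rewrite /S (nneseriesD1 (n := n))// leeDl// nneseries_ge0.
move: YS (SE m x); rewrite /= /Z.
case: (\sum_(m <= n <oo) _)%E (tail0 m x) => [t t0|_ _ _|//]; last exact: leey.
move=> + Sx; rewrite Sx /= !lee_fin => YS; rewrite (min_idPr _) ?normr0//.
by rewrite subr_ge0; exact: le_trans (ler_norm _) YS.
Unshelve. all: by end_near. Qed.

End Capacity.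

(** * Hahn-Banach *)

Section HahnBanach.
Variables (R : realType) (V : lmodType R) (S : set V).
Hypothesis S0 : S 0.
Hypothesis Slin : forall a b x y, S x -> S y -> S (a *: x + b *: y).

(** Everything is relative to the subspace [S], because the result is applied to $L^1(c)$ inside the
    space of all real functions on [T]. *)
Definition convex_on (f : V -> R) := forall x y (t : R), S x -> S y -> 0 <= t <= 1 ->
  f (t *: x + (1 - t) *: y) <= t * f x + (1 - t) * f y.

Let SD x y : S x -> S y -> S (x + y).
Proof. by move=> Sx Sy; have := Slin 1 1 Sx Sy; rewrite !scale1r. Qed.

Let SZ a x : S x -> S (a *: x).
Proof. by move=> Sx; have := Slin a 0 Sx S0; rewrite scaler0 addr0. Qed.

Let SN x : S x -> S (- x).
Proof. by move=> /(SZ (-1)); rewrite scaleN1r. Qed.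

(** This is convexity at the midpoint [0] of [x] and [- x]. It supplies the lower bound [- h (- x)]
    for chains of minorants of [h]. *)
Lemma convex_on_ge f x : convex_on f -> f 0 = 0 -> S x -> - f (- x) <= f x.
Proof.
move=> cf f0 Sx; have := cf x (- x) (2^-1) Sx (SN Sx).
have -> : (1 - 2^-1 : R) = 2^-1 by lra.
rewrite scalerN subrr f0; have -> : 0 <= (2^-1 : R) <= 1 by apply/andP; split; lra.
move=> /(_ isT); lra.
Qed.

(** Zorn's lemma is applied to the convex minorants of [h] vanishing at [0]; a chain of them is
    bounded by its pointwise infimum. *)
Lemma convex_on_minimal h : convex_on h -> h 0 = 0 ->
  exists f, [/\ convex_on f, f 0 = 0, forall x, S x -> f x <= h x &
    forall g, convex_on g -> g 0 = 0 -> (forall x, S x -> g x <= f x) ->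
      forall x, S x -> g x = f x].
Proof.
move=> ch h0.
pose K := [set f : V -> R | [/\ convex_on f, f 0 = 0,
  forall x, S x -> f x <= h x & forall x, ~ S x -> f x = 0]].
(* Extension by zero makes comparison on [S] the same as comparison everywhere. *)
pose cut (f : V -> R) x := if `[< S x >] then f x else 0.
have cutS f x : S x -> cut f x = f x by rewrite /cut; case: asboolP.
have cutN f x : ~ S x -> cut f x = 0 by rewrite /cut; case: asboolP.
have Kcut f : convex_on f -> f 0 = 0 -> (forall x, S x -> f x <= h x) -> K (cut f).
  move=> cf f0 fh; split.
  - by move=> x y t Sx Sy t01; rewrite !cutS//; [exact: cf|exact: Slin].
  - by rewrite cutS.
  - by move=> x Sx; rewrite cutS//; exact: fh.
  - by move=> x /cutN.
(* The order is reversed, so that a maximal element is a pointwise minimal function. *)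
pose le (f g : {f | K f}) := `[< forall x, sval g x <= sval f x >].
have [| | | |[f Kf] fmax] := @Zorn {f | K f} le.
- by move=> f; apply/asboolP.
- by move=> f g k /asboolP fg /asboolP gk; apply/asboolP => x; exact: le_trans (fg x).
- move=> [f Kf] [g Kg] /asboolP/= fg /asboolP/= gf; apply/eq_exist.
  by apply/funext => x; apply/eqP; rewrite eq_le gf fg.
- move=> A Atot; have [->|/set0P[f0 Af0]] := eqVneq A set0.
    by exists (exist _ _ (Kcut h ch h0 (fun x _ => lexx _))).
  pose E x := [set sval f x | f in A].
  have E0 x : E x (sval f0 x) by exists f0.
  have Elb x : S x -> has_inf (E x).
    move=> Sx; split; first by exists (sval f0 x).
    exists (- h (- x)) => _ [[f [cf f00 fh fN]] _ <-] /=.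
    by apply: le_trans (convex_on_ge cf f00 Sx); rewrite lerN2 fh//; exact: SN.
  have Einf f x : A f -> S x -> inf (E x) <= sval f x.
    by move=> Af Sx; apply: ge_inf; [exact: (Elb _ Sx).2|exists f].
  have Kg : K (cut (fun x => inf (E x))).
    apply: Kcut.
    + move=> x y t Sx Sy t01; apply/ler_addgt0Pr => e e0.
      have [_ [f1 Af1 <-] f1x] := inf_adherent e0 (Elb _ Sx).
      have [_ [f2 Af2 <-] f2y] := inf_adherent e0 (Elb _ Sy).
      (* Of two members of the chain nearly optimal at [x] and at [y], the smaller one is nearly
         optimal at both. *)
      have [f [Af fx fy]] : exists f, [/\ A f, sval f x < inf (E x) + e &
          sval f y < inf (E y) + e].
        case: (Atot _ _ Af1 Af2) => /asboolP f12.
          by exists f2; split => //; exact: le_lt_trans f1x.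
        by exists f1; split => //; exact: le_lt_trans f2y.
      apply: (le_trans (Einf _ _ Af (Slin t (1 - t) Sx Sy))).
      have [cf _ _ _] := svalP f; apply: (le_trans (cf _ _ _ Sx Sy t01)).
      move/andP: t01 => [t0 t1].
      have := ler_wpM2l t0 (ltW fx); have := ler_wpM2l (_ : 0 <= 1 - t) (ltW fy).
      rewrite subr_ge0 => /(_ t1); lra.
    + have -> : E 0 = [set 0]; last exact: inf1.
      apply/seteqP; split => [_ [f Af <-]|_ ->] /=; first by have [] := svalP f.
      by exists f0 => //; have [] := svalP f0.
    + move=> x Sx; apply: (le_trans (Einf _ _ Af0 Sx)).
      by have [_ _ + _] := svalP f0; exact.
  exists (exist _ _ Kg) => f Af; apply/asboolP => x /=.
  have [Sx|Sx] := pselect (S x); first by rewrite cutS//; exact: Einf.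
  by rewrite cutN//; have [_ _ _ ->] := svalP f.
have [cf f0 fh fN] := Kf; exists f; split => // g cg g0 gf x Sx.
have Kg : K (cut g).
  by apply: Kcut => // y Sy; exact: le_trans (gf _ Sy) (fh _ Sy).
have /(congr1 sval)/= /(congr1 (@^~ x)) : exist _ _ Kg = exist _ _ Kf.
  apply: fmax; apply/asboolP => y /=.
  have [Sy|Sy] := pselect (S y); first by rewrite cutS//; exact: gf.
  by rewrite cutN// fN.
by rewrite cutS.
Qed.

(** A minimal convex minorant is linear: each identity is obtained by exhibiting a convex function
    that vanishes at [0] and lies below [f], which minimality forces to equal [f]. *)
Theorem hahn_banach_convex h : convex_on h -> h 0 = 0 ->
  exists l : V -> R, (forall a b x y, S x -> S y ->
    l (a *: x + b *: y) = a * l x + b * l y) /\ forall x, S x -> l x <= h x.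
Proof.
move=> ch h0; have [f [cf f0 fh fmin]] := convex_on_minimal ch h0.
exists f; split => //.
have fZ1 t x : 0 < t -> t <= 1 -> S x -> f (t *: x) = t * f x.
  move=> t0 t1 Sx; have t_neq0 : t != 0 by rewrite gt_eqF.
  (* For [t <= 1], convexity between [x] and [0] places this rescaling below [f]. *)
  suff /(_ _ Sx) <- : forall x, S x -> t^-1 * f (t *: x) = f x by rewrite mulVKf.
  apply: fmin; [| by rewrite scaler0 f0 mulr0|].
    move=> y z s Sy Sz s01; rewrite scalerDr !scalerA ![t * _]mulrC -!scalerA.
    have := cf _ _ _ (SZ t Sy) (SZ t Sz) s01.
    move=> /(ler_wpM2l (ltW (_ : 0 < t^-1))); rewrite invr_gt0 => /(_ t0).
    by move/le_trans; apply; rewrite mulrDr !mulrA ![t^-1 * _]mulrC.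
  move=> y Sy; have := cf _ _ t Sy S0; rewrite scaler0 addr0 f0 mulr0 addr0.
  by rewrite (ltW t0) t1 => /(_ isT); rewrite ler_pdivrMl.
have fZ t x : 0 <= t -> S x -> f (t *: x) = t * f x.
  rewrite le_eqVlt => /orP[/eqP <- _|t0 Sx]; first by rewrite scale0r f0 mul0r.
  have [t1|/ltW t1] := leP t 1; first exact: fZ1.
  have ti : 0 < t^-1 by rewrite invr_gt0.
  have ti1 : t^-1 <= 1 by rewrite invf_le1.
  have := fZ1 _ _ ti ti1 (SZ t Sx).
  by rewrite scalerA mulVf ?gt_eqF// scale1r => ->; rewrite mulVKf ?gt_eqF.
have fD_le x y : S x -> S y -> f (x + y) <= f x + f y.
  move=> Sx Sy; have h01 : 0 <= (2^-1 : R) <= 1 by apply/andP; split; lra.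
  have := cf _ _ _ Sx Sy h01; have -> : (1 - 2^-1 : R) = 2^-1 by lra.
  rewrite -scalerDr fZ//; last exact: SD.
  by lra.
have fD x y : S x -> S y -> f (x + y) = f x + f y.
  move=> Sx Sy; apply/eqP; rewrite eq_le fD_le//=.
  (* The competitor is the infimum of [E z], which [t = 0] places below [f z]. Once it equals [f],
     the value [t = 1] gives the missing inequality [f x <= f (x + y) - f y]. *)
  pose E z := [set f (z + t *: y) - t * f y | t in [set t | 0 <= t]].
  have Elb z : S z -> has_inf (E z).
    move=> Sz; split; first by exists (f (z + 0 *: y) - 0 * f y), 0 => /=.
    exists (- f (- z)) => _ [t /= t0 <-].
    have := fD_le _ _ (SD Sz (SZ t Sy)) (SN Sz).
    by rewrite addrAC subrr add0r fZ//; lra.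
  have Einf t z : 0 <= t -> S z -> inf (E z) <= f (z + t *: y) - t * f y.
    by move=> t0 Sz; apply: ge_inf; [exact: (Elb _ Sz).2|exists t].
  suff /(_ _ Sx) gE : forall z, S z -> inf (E z) = f z.
    by have := Einf 1 _ ler01 Sx; rewrite gE scale1r mul1r lerBrDr.
  apply: fmin.
  - move=> z w s Sz Sw s01; apply/ler_addgt0Pr => e e0.
    have [_ [t1 /= t10 <-] h1] := inf_adherent e0 (Elb _ Sz).
    have [_ [t2 /= t20 <-] h2] := inf_adherent e0 (Elb _ Sw).
    have := cf _ _ _ (SD Sz (SZ t1 Sy)) (SD Sw (SZ t2 Sy)) s01.
    move/andP: s01 => [s0 s1]; have s1' : 0 <= 1 - s by rewrite subr_ge0.
    have t0 : 0 <= s * t1 + (1 - s) * t2 by rewrite addr_ge0// mulr_ge0.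
    have := Einf _ _ t0 (Slin s (1 - s) Sz Sw).
    rewrite !scalerDr addrACA !scalerA -scalerDl.
    have := ler_wpM2l s0 (ltW h1); have := ler_wpM2l s1' (ltW h2).
    by lra.
  - have -> : E 0 = [set 0]; last exact: inf1.
    apply/seteqP; split => [_ [t t0 <-]|_ ->] /=.
      by rewrite add0r fZ// subrr.
    by exists 0 => //=; rewrite scale0r addr0 mul0r subr0.
  - by move=> z Sz; have := Einf 0 _ (lexx _) Sz; rewrite scale0r addr0 mul0r subr0.
have fN x : S x -> f (- x) = - f x.
  move=> Sx; apply/eqP; rewrite -addr_eq0 -fD ?addNr ?f0//; exact: SN.
have fZr t x : S x -> f (t *: x) = t * f x.
  move=> Sx; have [t0|/ltW t0] := leP 0 t; first exact: fZ.
  rewrite -[t]opprK scaleNr fN; last exact: SZ.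
  have nt0 : 0 <= - t by rewrite oppr_ge0.
  by rewrite (fZ _ _ nt0 Sx) !mulNr.
by move=> a b x y Sx Sy; rewrite fD ?fZr//; exact: SZ.
Qed.

End HahnBanach.

(** * Daniell-Stone *)

Section ProbabilityOfMeasure.
Context d (X : measurableType d) (R : realType) (m : {measure set X -> \bar R}).
Hypothesis m1 : m setT = 1%E.

(** An alias of [m] whose argument is the proof of unit mass, so that the probability structure can
    be attached to it. *)
Definition mass1 of m setT = 1%E : set X -> \bar R := m.

HB.instance Definition _ := Measure.copy (mass1 m1) m.
HB.instance Definition _ := Measure_isProbability.Build _ _ _ (mass1 m1) m1.

Definition probability_of_measure : probability X R := mass1 m1.

End ProbabilityOfMeasure.

Section DaniellStone.
Variables (R : realType) (T : ptopologicalType) (L : set (T -> R)).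
Hypotheses (HL : vector_lattice_Cb L).
Hypotheses (mT : metrizable R T) (sT : separable T) (gL : generates_topology L).
Variable l : (T -> R) -> R.
Hypothesis l_linear : forall a b f g, L f -> L g ->
  l (fun x => a * f x + b * g x) = a * l f + b * l g.
Hypothesis l_ge0 : forall f, L f -> (forall x, 0 <= f x) -> 0 <= l f.
Hypothesis l_decreasing : forall fn : nat -> T -> R, (forall n, L (fn n)) ->
  (forall n x, fn n.+1 x <= fn n x) ->
  (forall x, (fun n => fn n x) @ \oo --> (0 : R)) ->
  forall e, 0 < e -> exists n, l (fn n) < e.
Hypothesis l1 : l (fun=> 1) = 1.

Let lD f g : L f -> L g -> l (fun x => f x + g x) = l f + l g.
Proof.
by move=> Lf Lg; have := l_linear 1 1 Lf Lg; under eq_fun do rewrite !mul1r; rewrite !mul1r.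
Qed.

Let lZ a f : L f -> l (fun x => a * f x) = a * l f.
Proof.
move=> Lf; have := l_linear a 0 Lf Lf.
by under eq_fun do rewrite mul0r addr0; rewrite mul0r addr0.
Qed.

Let l_le f g : L f -> L g -> (forall x, f x <= g x) -> l f <= l g.
Proof.
move=> Lf Lg fg; have := l_ge0 (latticeB HL Lg Lf).
have := l_linear 1 (-1) Lg Lf; under eq_fun do rewrite mul1r mulN1r.
move=> -> /(_ (fun x => _)); rewrite mul1r mulN1r subr_ge0; apply => x.
by rewrite subr_ge0.
Qed.

Let cl (f : T -> R) := l (fun x => `|f x|).

(** Through this lemma the results on [cext] provide a countably subadditive set function [mu]. A
    sequence decreasing to [0] is nonnegative, so [cl] agrees with [l] along it and the Daniell
    condition becomes the capacity axiom. *)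
Lemma functional_capacity : capacity L cl.
Proof.
have Ln := lattice_norm HL.
split.
- move=> f g Lf Lg; rewrite /cl -lD; [|exact: Ln|exact: Ln].
  apply: l_le => [||x]; first by apply: Ln; exact: latticeD.
    by apply: latticeD => //; exact: Ln.
  exact: ler_normD.
- move=> a f Lf; rewrite /cl -lZ; last exact: Ln.
  by under eq_fun do rewrite normrM.
- by move=> f g Lf Lg fg; apply: l_le => //; exact: Ln.
move=> fn Lf df cf.
have f0 n x : 0 <= fn n x.
  have fh : {homo fn^~ x : m n / (m <= n)%N >-> n <= m}.
    by apply: (homo_leq (r := fun a b => b <= a)) => // y z t yz zt; exact: le_trans zt yz.
  have := nonincreasing_cvgn_ge fh (cvgP _ (cf x)) n.
  by rewrite (cvg_lim _ (cf x)).
have clE n : cl (fn n) = l (fn n).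
  by congr l; apply/funext => x; rewrite ger0_norm.
apply/eqP; rewrite eq_le; apply/andP; split.
  apply/lee_addgt0Pr => e e0; rewrite add0e.
  have [n ne] := l_decreasing Lf df cf e0.
  by apply: ge_ereal_inf; exists (cl (fn n))%:E; [exists n|rewrite clE lee_fin ltW].
by apply: le_ereal_inf_tmp => _ [n _ <-]; rewrite clE lee_fin l_ge0.
Qed.

Let mu (A : set T) := cext L cl (\1_A : T -> R).
Let Hcl := functional_capacity.

Let mu0 : mu set0 = 0%E.
Proof.
by rewrite /mu indic0; exact: (cext0 HL Hcl).
Qed.

Let mu_ge0 A : (0 <= mu A)%E.
Proof. exact: cext_ge0. Qed.

Let le_mu : {homo mu : A B / A `<=` B >-> (A <= B)%E}.
Proof.
move=> A B AB; apply: le_cext => x; rewrite !indicE !ger0_norm// ler_nat.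
by case: (boolP (x \in A)) => //; rewrite !inE => /AB; rewrite -(in_setE B) => ->.
Qed.

Let mu_sigma_subadditive : sigma_subadditive mu.
Proof.
move=> F; apply: cext_nneseries => // x.
rewrite indicE; case: (boolP (x \in _)); last first.
  by rewrite normr0 => _; apply: nneseries_ge0.
rewrite inE => -[n _ Fnx]; rewrite (nneseriesD1 (n := n))//.
rewrite indicE mem_set// normr1 leeDl// nneseries_ge0//.
Qed.

Let nu : {outer_measure set T -> \bar R} :=
  HB.pack mu (isOuterMeasure.Build R T mu mu0 mu_ge0 le_mu mu_sigma_subadditive).

Let muT : mu setT = 1%E.
Proof.
rewrite /mu indicT (cext_lattice HL Hcl); last exact: lattice_cst.
by rewrite /cl; under eq_fun do rewrite normr1; rewrite l1.
Qed.

(** Let [f] be a lower semicontinuous majorant of the indicator of [X]. Its restriction [f1] to the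
    open set [G] is lower semicontinuous, and for [phi] in [L] between [0] and [f1] the difference
    [f2 = f - phi] majorizes the indicator of [X] minus [G], because [phi] vanishes off [G]. If
    [psi] in [L] lies between [0] and [f2], then [psi + phi <= f]. *)
Let open_caratheodory G : open G -> nu.-caratheodory G.
Proof.
move=> oG; apply: le_caratheodory_measurable => X; rewrite /nu /=.
have muD : mu (X `&` ~` G) \is a fin_num.
  rewrite ge0_fin_numE//; apply: le_lt_trans (ltry 1).
  by rewrite -muT; exact: le_mu.
rewrite {3}/mu; apply: le_ereal_inf_tmp => _ [f [lf Xf] <-].
have f0 x : (0 <= f x)%E by apply: le_trans (Xf x); rewrite lee_fin.
pose f1 x := if x \in G then f x else 0%E.
have lf1 : lower_semicontinuous f1.
  move=> x a; rewrite /f1; case: ifPn => [xG /lf[V nV Vf]|_ a0].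
    exists (V `&` G); last by move=> y [/Vf ? ?]; rewrite mem_set.
    by apply: filterI => //; apply: open_nbhs_nbhs; split => //; exact: set_mem.
  exists setT; first exact: filterT.
  by move=> y _; case: ifP => // _; exact: lt_le_trans (f0 y).
have : (mu (X `&` G) <= c_lsc L cl f1)%E.
  apply: cext_le_c_lsc => // x; rewrite /f1 indicE in_setI andbC.
  case: ifPn => xG /=; last by rewrite normr0.
  by apply: le_trans (Xf x); rewrite indicE.
move=> /(leeD2r (mu (X `&` ~` G))) /le_trans; apply.
rewrite -leeBrDr//; apply: ge_ereal_sup => _ [phi [Lphi phif] <-].
rewrite leeBrDr//.
pose f2 x := (f x - (phi x)%:E)%E.
have phi_f x : ((phi x)%:E <= f x)%E.
  by apply: (le_trans (phif x).2); rewrite /f1; case: ifP.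
have lf2 : lower_semicontinuous f2.
  move=> x a; rewrite /f2 lteBrDr// -EFinD => /lte_dense[b ab /lf[V nV Vf]].
  have /continuousP cphi := (Cb_bounded_continuous HL Lphi).1.
  exists (V `&` [set y | phi y < b - a]).
    apply: filterI => //; apply: open_nbhs_nbhs; split; last by rewrite /= ltrBrDl.
    exact: cphi _ (@open_lt R (b - a)).
  move=> y [/Vf bf pb]; rewrite lteBrDr// -EFinD; apply: lt_trans bf.
  by rewrite lte_fin -ltrBrDl.
have : (mu (X `&` ~` G) <= c_lsc L cl f2)%E.
  apply: cext_le_c_lsc => // x; rewrite /f2 indicE in_setI in_setC.
  have [xG|xG] := boolP (x \in G); rewrite [~~ _]/= ?andbF ?andbT normr_nat.
    by rewrite leeBrDr// add0e.
  have [p0] := phif x; rewrite /f1 (negbTE xG) lee_fin => p0'.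
  have -> : phi x = 0 by apply/eqP; rewrite eq_le p0 p0'.
  by rewrite sube0; apply: le_trans (Xf x); rewrite indicE normr_nat.
move=> /(leeD2l (cl phi)%:E) /le_trans; apply.
rewrite addeC -leeBrDr//; apply: ge_ereal_sup => _ [psi [Lpsi psif] <-].
rewrite leeBrDr// -EFinD.
(* On nonnegative functions [cl] is [l], hence additive and not merely subadditive. *)
have -> : (cl psi + cl phi = cl (fun x => psi x + phi x))%R.
  rewrite /cl -lD; [|exact: lattice_norm|exact: lattice_norm].
  congr l; apply/funext => x; have [p0 _] := phif x; have [q0 _] := psif x.
  by rewrite !ger0_norm// addr_ge0.
apply: c_lsc_ub => [|x]; first exact: latticeD.
have [p0 _] := phif x; have [q0] := psif x.
by rewrite /f2 leeBrDr// => qf; rewrite addr_ge0// EFinD.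
Qed.

Let borel_semi_sigma_additive : semi_sigma_additive (mu : set (borel T) -> \bar R).
Proof.
have sub : (measurable : set (set (borel T))) `<=` nu.-caratheodory.
  apply: smallest_sub open_caratheodory.
  exact: (sigma_algebra_measurable (caratheodory_type nu)).
move=> F mF tF mUF.
exact: (@caratheodory_measure_sigma_additive R T nu F (fun i => sub _ (mF i)) tF
  (sub _ mUF)).
Qed.

Let borel_measure : {measure set (borel T) -> \bar R} :=
  HB.pack (mu : set (borel T) -> \bar R)
    (isMeasure.Build _ (borel T) R mu mu0 mu_ge0 borel_semi_sigma_additive).

Let Q : probability (borel T) R := probability_of_measure (m := borel_measure) muT.

Lemma lattice_measurable phi : L phi -> measurable_fun [set: borel T] (phi : borel T -> R).
Proof.
move=> Lphi; apply: (measurability _ (RGenOInfty.measurableE R)).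
move=> _ [_ [a ->] <-]; rewrite setTI; apply: sub_sigma_algebra.
have /continuousP cphi := (Cb_bounded_continuous HL Lphi).1.
rewrite preimage_itvoy.
exact: (cphi _ (@open_gt R a)).
Qed.

Lemma lattice_integrable (P : probability (borel T) R) phi : L phi ->
  P.-integrable setT (EFin \o phi).
Proof.
move=> Lphi; apply: measurable_bounded_integrable => //.
- exact: le_lt_trans (probability_le1 P measurableT) (ltry 1).
- exact: lattice_measurable.
- have [M phiM] := (Cb_bounded_continuous HL Lphi).2.
  by exists M; split; [exact: num_real|move=> y My x _; exact: le_trans (ltW My)].
Qed.

(** The staircase counting the integers [k < N] with [k < n * phi x] lies between [n * phi] and
    [n * phi + 1]. Subadditivity of [cext] bounds [n * l phi] by the sum of the [Q (G k)], which is
    the integral of the staircase; dividing by [n] leaves an error [1 / n <= e]. *)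
Let functional_le_integral phi : L phi -> (forall x, 0 <= phi x) ->
  l phi <= \int[Q]_x phi x.
Proof.
move=> Lphi phi0; apply/ler_addgt0Pr => e e0.
pose n := (Num.bound e^-1).+1; have n0 : 0 < n%:R :> R by rewrite ltr0n.
have ne : n%:R^-1 <= e.
  rewrite -[leRHS]invrK lef_pV2 ?posrE ?invr_gt0//; apply: ltW.
  apply: (lt_trans (archi_boundP _)); first by rewrite invr_ge0 ltW.
  by rewrite ltr_nat.
have [M phiM] := (Cb_bounded_continuous HL Lphi).2.
(* Since [n * phi <= N], the levels from [N] on are empty and finitely many steps suffice. *)
pose N := Num.bound (n%:R * M).
have nphiN x : n%:R * phi x <= N%:R.
  have Mn : n%:R * phi x <= n%:R * M.
    by rewrite ler_pM2l//; exact: le_trans (ler_norm _) (phiM x).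
  apply: (le_trans Mn); apply/ltW/archi_boundP; apply: le_trans Mn.
  by rewrite mulr_ge0.
have Lnphi : L (fun x => n%:R * phi x) by exact: latticeZ.
pose G (k : nat) := [set x | k%:R < n%:R * phi x].
have mG k : measurable (G k : set (borel T)).
  apply: sub_sigma_algebra.
  have /continuousP cphi := (Cb_bounded_continuous HL Lnphi).1.
  exact: (cphi _ (@open_gt R k%:R)).
have indG k x : \1_(G k) x = ((k%:R < n%:R * phi x)%R : nat)%:R :> R.
  by rewrite indicE; congr (nat_of_bool _)%:R; apply/idP/idP; rewrite inE.
have staircase (t : R) m : 0 <= t -> t <= m%:R ->
    t <= \sum_(k < m) ((k%:R < t)%R : nat)%:R <= t + 1.
  move=> t0; elim: m => [|m IH].
    by move=> t0'; rewrite big_ord0 t0' addr_ge0.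
  rewrite big_ord_recr /=; case: ltP => [mt tm|/IH//]; last by rewrite addr0.
  have -> : \sum_(k < m) ((k%:R < t)%R : nat)%:R = m%:R :> R.
    rewrite (eq_bigr (fun=> 1)) ?sumr_const ?card_ord// => k _.
    by rewrite (le_lt_trans _ mt)// ler_nat ltnW.
  by rewrite natr1 tm/= -natr1 lerD2r ltW.
have nl : n%:R * l phi <= n%:R * \int[Q]_x phi x + 1.
  rewrite -lZ// -lee_fin.
  have -> : l (fun x => n%:R * phi x) = cl (fun x => n%:R * phi x).
    by congr l; apply/funext => x; rewrite ger0_norm// mulr_ge0.
  rewrite -(cext_lattice HL Hcl Lnphi).
  apply: (@le_trans _ _ (\sum_(k < N) Q (G k))%E).
    apply: (@le_trans _ _ (cext L cl (fun x => \sum_(k < N) \1_(G k) x)%R)).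
      apply: le_cext => x; under eq_bigr do rewrite indG.
      have tx : 0 <= n%:R * phi x by rewrite mulr_ge0.
      rewrite !ger0_norm ?sumr_ge0//.
      by have /andP[] := staircase _ N tx (nphiN x).
    exact: (cext_sum HL Hcl mT sT gL N (fun k => \1_(G k))).
  have -> : (\sum_(k < N) Q (G k) = \int[Q]_x (\sum_(k < N) (\1_(G k) x)%:E))%E.
    rewrite ge0_integral_sum//; last first.
    - by move=> k; apply/measurable_EFinP; exact: measurable_indic.
    by apply: eq_bigr => k _; rewrite integral_indic// setIT.
  have L1 : L (fun x => n%:R * phi x + 1).
    by apply: latticeD => //; exact: lattice_cst.
  have -> : n%:R * \int[Q]_x phi x + 1 = \int[Q]_x (n%:R * phi x + 1).
    rewrite RintegralD//; last 2 first.
    - exact: (@lattice_integrable Q _ Lnphi).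
    - exact: (@lattice_integrable Q _ (lattice_cst HL 1)).
    rewrite RintegralZl//; last exact: lattice_integrable.
    by rewrite Rintegral_cst// mul1r [fine _](_ : _ = 1)//= -[1]/(fine 1%:E) -muT.
  rewrite fineK; last exact: integrable_fin_num (lattice_integrable Q L1).
  apply: ge0_le_integral => //.
  - by move=> x _; rewrite sumEFin lee_fin sumr_ge0.
  - apply: emeasurable_sum => k; apply/measurable_EFinP; exact: measurable_indic.
  - apply/measurable_EFinP; exact: (lattice_measurable L1).
  move=> x _; rewrite sumEFin lee_fin; under eq_bigr do rewrite indG.
  have tx : 0 <= n%:R * phi x by rewrite mulr_ge0.
  by have /andP[] := staircase _ N tx (nphiN x).
rewrite -(ler_pM2l n0); apply: (le_trans nl); rewrite mulrDr lerD2l.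
by rewrite -ler_pdivrMl// mulr1.
Qed.

(** One inequality is enough, as it can be applied to [- phi] too. Adding a constant bound [M]
    reduces it to nonnegative functions; both sides increase by [M] because [l] and [Q] have mass
    one. *)
Theorem daniell_stone : exists P : probability (borel T) R,
  forall phi, L phi -> l phi = \int[P]_x phi x.
Proof.
exists Q => phi Lphi.
suff le psi : L psi -> l psi <= \int[Q]_x psi x.
  apply/eqP; rewrite eq_le le//=; have := le _ (latticeN HL Lphi).
  have -> : l (fun x => - phi x) = - l phi.
    by have := lZ (-1) Lphi; under eq_fun do rewrite mulN1r; rewrite mulN1r.
  have := RintegralZl (-1) measurableT (lattice_integrable Q Lphi).
  by rewrite mulN1r; under eq_Rintegral do rewrite mulN1r; move=> ->; rewrite lerN2.
move=> Lpsi; have [M psiM] := (Cb_bounded_continuous HL Lpsi).2.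
have LM := lattice_cst HL M.
have := functional_le_integral (latticeD HL Lpsi LM).
rewrite lD// RintegralD//; last 2 first.
- exact: (lattice_integrable Q Lpsi).
- exact: (lattice_integrable Q LM).
have -> : l (fun=> M) = M by have := lZ M (lattice_cst HL 1); rewrite l1 !mulr1.
rewrite Rintegral_cst//.
have -> : M * fine (Q setT) = M by rewrite [Q setT]muT /= mulr1.
rewrite lerD2r; apply => x; rewrite -lerBlDr sub0r.
by have := psiM x; rewrite ler_norml => /andP[].
Qed.

End DaniellStone.

(** * Continuity and duality of risk measures *)

Section RiskMeasure.
Variables (R : realType) (T : ptopologicalType) (L : set (T -> R)).
Variables (c rho : (T -> R) -> R).
Hypotheses (HL : vector_lattice_Cb L) (Hc : capacity L c).
Hypotheses (mT : metrizable R T) (sT : separable T) (gL : generates_topology L).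
Hypothesis Hrho : convex_risk_measure L c rho.

Let LD := L1D HL Hc mT sT gL.
Let LN := L1N HL Hc mT sT gL.
Let LB := L1B HL Hc mT sT gL.
Let LZ := L1Z HL Hc mT sT gL.
Let LL := L1_lattice HL Hc.

Lemma risk_le X Y : L1 L c X -> L1 L c Y -> L1_le L c X Y -> rho Y <= rho X.
Proof. by case: Hrho => _ + _ _; exact. Qed.

Lemma risk_convex X Y (t : R) : L1 L c X -> L1 L c Y -> 0 <= t <= 1 ->
  rho (fun x => t * X x + (1 - t) * Y x) <= t * rho X + (1 - t) * rho Y.
Proof. by case: Hrho => _ _ + _; exact. Qed.

Lemma risk_cst X a : L1 L c X -> rho (fun x => X x + a) = rho X - a.
Proof. by case: Hrho => _ _ _; exact. Qed.

(* A sequence [Y n -> 0] along which [rho] blows up could be chosen with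
   summable norms; it would then be bounded below by a single [- Z] in [L^1(c)]. *)
Lemma risk_locally_bounded X : L1 L c X -> exists d M : R, 0 < d /\
  forall Y, L1 L c Y -> (cext L c Y < d%:E)%E -> rho (fun x => X x + Y x) <= M.
Proof.
move=> LX; apply: contrapT => nb.
have /choice[Y YP] : forall n : nat, exists Y, [/\ L1 L c Y,
    (cext L c Y < (1 / (2 ^ n.+1)%:R)%:E)%E & n%:R < rho (fun x => X x + Y x)].
  move=> n; apply: contrapT => nY; apply: nb.
  exists (1 / (2 ^ n.+1)%:R), n%:R; split; first by rewrite divr_gt0// ltr0n expn_gt0.
  by move=> Y LY cY; rewrite leNgt; apply/negP => nY'; apply: nY; exists Y.
have LY n : L1 L c (Y n) by case: (YP n).
have cN n : (cext L c (fun x => - Y n x)%R <= (1 / (2 ^ n.+1)%:R)%:E)%E.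
  apply: le_trans (ltW (_ : cext L c (Y n) < _)%E); last by case: (YP n).
  by apply: le_cext => x; rewrite normrN.
have [||Z LZ' ZY] := L1_upper_bound HL Hc mT sT gL (Y := fun n x => - Y n x).
- by move=> n; exact: LN.
- apply: (le_lt_trans _ (ltry 1)); apply: le_trans (epsilon_trick0 xpredT ler01).
  by apply: lee_nneseries => [n _ _|n _]; [exact: cext_ge0|exact: cN].
have XZ := LB LX LZ'.
(* Since [- Z <= Y n], the number [rho (X - Z)] bounds every [rho (X + Y n) > n]; an integer [n]
   above it gives the contradiction. *)
have := archi_boundP (normr_ge0 (rho (fun x => X x - Z x))).
set n := Num.bound _; apply/negP; rewrite -leNgt.
apply: le_trans (ler_norm _); have [_ _ /ltW nY] := YP n.
apply: (le_trans nY); apply: risk_le => //; first exact: LD.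
rewrite /L1_le; have -> : (fun x => X x + Y n x) \- (fun x => X x - Z x) =
    Z \- (fun x => - Y n x).
  by apply/funext => x /=; ring.
exact: ZY.
Qed.

(** Writing [X + W] as a convex combination of [X + n W] and [X] with weight [1 / n] on the former
    turns the local bound [M] into [rho (X + W) - rho X <= (M - rho X) / n < e]. The opposite
    inequality uses that [X] is the midpoint of [Y] and its reflection [X + (X - Y)]. *)
Lemma risk_continuous : L1_continuous L c rho.
Proof.
move=> X LX e e0; have [d [M [d0 dM]]] := risk_locally_bounded LX.
pose b := M - rho X.
pose n := (Num.bound (`|b| / e)).+1; have n0 : 0 < n%:R :> R by rewrite ltr0n.
have ne : b < e * n%:R.
  apply: le_lt_trans (ler_norm _) _; rewrite mulrC -ltr_pdivrMr//.
  by apply: (lt_trans (archi_boundP _)); rewrite ?ltr_nat// divr_ge0// ltW.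
have step W : L1 L c W -> (cext L c W < (d / n%:R)%:E)%E ->
    rho (fun x => X x + W x) - rho X < e.
  move=> LW Wd; have LnW := LZ n%:R LW.
  have nWd : (cext L c (fun x => n%:R * W x)%R < d%:E)%E.
    apply: le_lt_trans (cext_natmul HL Hc mT sT gL (n := n) (h := W) _) _.
      by move=> x; rewrite normrM normr_nat.
    by rewrite muleC -lte_pdivlMr// mulrC EFinM.
  have := risk_convex (t := n%:R^-1) (LD LX LnW) LX.
  rewrite invr_ge0 ltW// invf_le1// ler1n => /(_ isT).
  have -> : (fun x => n%:R^-1 * (X x + n%:R * W x) + (1 - n%:R^-1) * X x) =
      (fun x => X x + W x).
    by apply/funext => x; field; rewrite gt_eqF.
  move=> h; have := dM _ LnW nWd.
  rewrite -(ler_pM2l (_ : 0 < n%:R^-1)) ?invr_gt0// => h2.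
  have : n%:R^-1 * b < e by rewrite mulrC ltr_pdivrMr.
  by rewrite /b; lra.
exists (d / n%:R); first by rewrite divr_gt0.
move=> Y LY YX; have LW := LB LY LX; have LW' := LB LX LY.
have XY : (cext L c (fun x => X x - Y x)%R < (d / n%:R)%:E)%E.
  by apply: le_lt_trans YX; apply: le_cext => x /=; rewrite distrC.
have := step _ LW YX; have := step _ LW' XY.
have -> : (fun x => X x + (Y x - X x)) = Y by apply/funext => x; ring.
move=> h1 h2.
have := risk_convex (t := 2^-1) LY (LD LX LW').
have -> : 0 <= (2^-1 : R) <= 1 by apply/andP; split; lra.
have -> : (fun x => 2^-1 * Y x + (1 - 2^-1) * (X x + (X x - Y x))) = X.
  by apply/funext => x; field.
move=> /(_ isT) h3; rewrite ltr_norml; apply/andP; split; lra.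
Qed.

(** The functional [l] comes from Hahn-Banach below [Y |-> rho (X - Y) - rho X], and continuity of
    [rho] at [X] makes it continuous. *)
Lemma risk_subgradient X : L1 L c X -> exists (Q : probability (borel T) R) l,
  dual_ext L c Q l /\ forall Y, L1 L c Y -> l Y <= rho (fun x => X x - Y x) - rho X.
Proof.
move=> LX; have L0 := LL (lattice_cst HL 0).
have [|||l [l_lin l_le]] := @hahn_banach_convex R (T -> R^o) (L1 L c)
    L0 _ (fun Y => rho (fun x => X x - Y x) - rho X).
- by move=> a b Y Z LY LZ'; exact: LD (LZ a LY) (LZ b LZ').
- move=> Y Z t LY LZ' t01.
  have := risk_convex (LB LX LY) (LB LX LZ') t01.
  have -> : (fun x => t * (X x - Y x) + (1 - t) * (X x - Z x)) =
      (fun x => X x - (t *: Y + (1 - t) *: Z : T -> R^o) x).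
    apply/funext => x; transitivity (X x - (t * Y x + (1 - t) * Z x)) => //.
    by ring.
  by lra.
- have -> : (fun x => X x - (0 : T -> R^o) x) = X; last by rewrite subrr.
  by apply/funext => x; rewrite subr0.
have lin a b Y Z : L1 L c Y -> L1 L c Z ->
    l (fun x => a * Y x + b * Z x) = a * l Y + b * l Z.
  exact: l_lin.
have lN Y : L1 L c Y -> l (fun x => - Y x) = - l Y.
  move=> LY; have := lin (-1) 0 _ _ LY LY.
  by under eq_fun do rewrite mulN1r mul0r addr0; rewrite mulN1r mul0r addr0.
have small e : 0 < e -> exists2 d, 0 < d &
    forall Y, L1 L c Y -> (cext L c Y < d%:E)%E -> `|l Y| < e.
  move=> e0; have [d d0 dP] := risk_continuous LX e0; exists d => //.
  have bound Y : L1 L c Y -> (cext L c Y < d%:E)%E -> l Y < e.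
    move=> LY Yd; apply: (le_lt_trans (l_le _ LY)).
    apply: le_lt_trans (ler_norm _) _; apply: dP; first exact: LB.
    by apply: le_lt_trans Yd; apply: le_cext => x /=; rewrite addrAC subrr add0r normrN.
  move=> Y LY Yd; rewrite ltr_norml ltrNl -lN// !bound//; first exact: LN.
  by apply: le_lt_trans Yd; apply: le_cext => x; rewrite normrN.
(* By translation invariance the dominating function takes the values [1] and [-1] at the constants
   [1] and [-1], which bounds [l 1] from both sides. *)
have l1 : l (fun=> 1) = 1.
  have L1c := LL (lattice_cst HL 1).
  have lc := l_le _ L1c; have := l_le _ (LN L1c).
  rewrite lN//; move: lc; rewrite risk_cst//.
  by rewrite risk_cst//; lra.
have l_ge0 phi : L phi -> (forall x, 0 <= phi x) -> 0 <= l phi.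
  move=> Lphi phi0; have LP := LL Lphi; have := l_le _ (LN LP); rewrite lN//.
  rewrite lerNl => /(le_trans _); apply; rewrite oppr_ge0 subr_le0.
  apply: risk_le => //; first exact: LB LX (LN LP).
  (* The constant sequence [phi] witnesses [X <= X + phi], so the dominating function is nonpositive
     at [- phi]. *)
  exists (fun=> phi); split => // g' _.
  have -> : (fun x => X x - - phi x) \- X = phi by apply/funext => x /=; ring.
  by move=> ->; exact: cvg_cst.
have [||Q QP] := daniell_stone HL mT sT gL (l := l) _ l_ge0 _ l1.
- by move=> a b f g Lf Lg; apply: lin; exact: LL.
- move=> fn Lfn dfn cfn e /small[d d0 dP].
  have [n nd] := capacity_decreasing Hc Lfn dfn cfn d0; exists n.
  apply: le_lt_trans (ler_norm _) _; apply: dP; first exact: LL.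
  by rewrite (cext_lattice HL Hc) ?lte_fin.
exists Q, l; split => //.
have lB Y Z : L1 L c Y -> L1 L c Z -> l (fun x => Y x - Z x) = l Y - l Z.
  move=> LY LZ'; have := lin 1 (-1) _ _ LY LZ'.
  by under eq_fun do rewrite mul1r mulN1r; rewrite mul1r mulN1r.
split => //.
- move=> Y Z LY LZ' YZ; apply/eqP; rewrite -subr_eq0 -normr_le0.
  apply/ler_addgt0Pr => e /small[d d0 dP]; rewrite add0r ltW// -lB//.
  by apply: dP; [exact: LB|rewrite [cext _ _ _]YZ lte_fin].
- by move=> Y Z a b; exact: lin.
- move=> Y LY e /small[d d0 dP]; exists d => // Z LZ' ZY.
  by rewrite -lB//; apply: dP; first exact: LB.
Qed.

(** The extension picked in [EQ] is arbitrary, but two continuous extensions agree on the dense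
    subspace [L], hence on $L^1(c)$. *)
Lemma EQ_dual_ext (Q : probability (borel T) R) l X : dual_ext L c Q l -> L1 L c X ->
  EQ L c Q X = l X.
Proof.
move=> lP LX; rewrite /EQ.
have [l' [l'P ->]] : [set r | exists l, dual_ext L c Q l /\ r = l X] (xget 0
  [set r | exists l, dual_ext L c Q l /\ r = l X]) by apply: xgetPex; exists (l X), l.
have [l_L _ _ l_cont] := lP; have [l'_L _ _ l'_cont] := l'P.
apply/eqP; rewrite -subr_eq0 -normr_le0; apply/ler_addgt0Pr => e e0; rewrite add0r.
have e2 : 0 < e / 2 by rewrite divr_gt0.
have [d d0 dP] := l_cont X LX _ e2; have [d' d'0 d'P] := l'_cont X LX _ e2.
have m0 : 0 < Num.min d d' by rewrite lt_min d0.
have [phi Lphi Xphi] := LX.2 _ m0.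
have phiX : (cext L c (phi \- X)%R < (Num.min d d')%:E)%E.
  by apply: le_lt_trans Xphi; apply: le_cext => x /=; rewrite distrC.
have h1 := dP _ (LL Lphi) (lt_le_trans phiX _).
have h2 := d'P _ (LL Lphi) (lt_le_trans phiX _).
rewrite -(subrKA (l' phi)) (splitr e); apply: le_trans (ler_normD _ _) _.
rewrite lerD//; first by rewrite distrC ltW// h2// lee_fin ge_min lexx orbT.
by rewrite l'_L// -l_L// ltW// h1// lee_fin ge_min lexx.
Qed.

(** Each term is at most [rho X] because [X] competes in the supremum [alpha]. The value [rho X] is
    attained at the probability [Q] of a subgradient at [X], where that supremum is reached at [X]
    itself. *)
Lemma risk_dual_representation X : L1 L c X ->
  (rho X)%:E = ereal_sup [set ((EQ L c Q (fun x => - X x))%:E - alpha L c rho Q)%E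
                         | Q in [set Q : probability (borel T) R | in_dual L c Q]].
Proof.
move=> LX; apply/eqP; rewrite eq_le; apply/andP; split; last first.
  apply: ge_ereal_sup => _ [Q _ <-].
  (* In this form only the subtracted penalties remain to be compared, and [alpha] may be
     infinite. *)
  have -> : (rho X)%:E = ((EQ L c Q (fun x => - X x))%:E -
      ((EQ L c Q (fun x => - X x))%:E - (rho X)%:E))%E.
    by rewrite -!EFinB; congr EFin; ring.
  by apply: leeB => //; apply: ereal_sup_ubound; exists X.
have [Q [l [lP l_le]]] := risk_subgradient LX; have [_ _ l_lin _] := lP.
apply: le_ereal_sup_tmp; eexists; first by exists Q => //; exists l.
have -> : (rho X)%:E = ((EQ L c Q (fun x => - X x))%:E -
    ((EQ L c Q (fun x => - X x))%:E - (rho X)%:E))%E.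
  by rewrite -!EFinB; congr EFin; ring.
apply: leeB => //; apply: ge_ereal_sup => _ [Y LY <-].
rewrite !(EQ_dual_ext lP); [|exact: LN|exact: LN].
rewrite -!EFinB lee_fin.
have lN Z : L1 L c Z -> l (fun x => - Z x) = - l Z.
  move=> LZ'; have := l_lin _ _ (-1) 0 LZ' LZ'.
  by under eq_fun do rewrite mulN1r mul0r addr0; rewrite mulN1r mul0r addr0.
have := l_lin _ _ 1 (-1) LX LY; under eq_fun do rewrite mul1r mulN1r.
have := l_le _ (LB LX LY).
have -> : (fun x => X x - (X x - Y x)) = Y by apply/funext => x; ring.
by move=> + lB; rewrite lB !lN//; lra.
Qed.

End RiskMeasure.

Theorem theorem3p2 (R : realType) (T : ptopologicalType)
  (L : set (T -> R)) (c : (T -> R) -> R) (rho : (T -> R) -> R) :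
  metrizable R T -> separable T ->
  vector_lattice_Cb L -> generates_topology L ->
  capacity L c -> prokhorov L c ->
  convex_risk_measure L c rho ->
  L1_continuous L c rho /\
  forall X, L1 L c X ->
    (rho X)%:E = ereal_sup [set ((EQ L c Q (fun x => - X x))%:E - alpha L c rho Q)%E
                           | Q in [set Q : probability (borel T) R | in_dual L c Q]].
Proof.
move=> mT sT HL gL Hc _ Hrho; split; first exact: risk_continuous.
by move=> X; exact: risk_dual_representation.
Qed.
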